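(* Let $r \ge 2$ be an integer and let $G$ be an $r$-regular graph. Then \[ \alpha(G) \le \frac{r}{2}\gamma_t(G), \] with equality if and only if $G \in \mathcal{G}_r$.
   Context: All graphs are finite, simple and undirected. $\alpha(G)$ denotes the independence number of $G$ (maximum size of a set of pairwise non-adjacent vertices). A total dominating set of $G$ is a set $S \subseteq V(G)$ such that every vertex of $G$ (including those in $S$) has a neighbor in $S$; $\gamma_t(G)$ is the minimum cardinality of a total dominating set. For $r \ge 2$, $\mathcal{G}_r$ denotes the family of all $r$-regular bipartite graphs $G$ for which there exists a partition $V(G) = A \cup B$ such that the subgraph induced by $A$ is $(r-1)$-regular and the subgraph induced by $B$ is $1$-regular. *)

(* Defs.v *)
From mathcomp Require Import all_boot all_order all_algebra.

Set Implicit Arguments.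
Unset Strict Implicit.
Unset Printing Implicit Defensive.

Record sgraph := SGraph {
  svertex :> finType;
  sedge : rel svertex;
  sedge_sym : symmetric sedge;
  sedge_irrefl : irreflexive sedge }.

Section Graphs.
Variable G : sgraph.
Implicit Types (x y : G) (A B S : {set G}).

Definition neighbors x : {set G} := [set y | sedge x y].

Definition regular (k : nat) : Prop := forall x, #|neighbors x| = k.

Definition independent A : bool :=
  [forall x in A, forall y in A, ~~ sedge x y].

Definition alpha : nat := \max_(A : {set G} | independent A) #|A|.

Definition total_dominating S : bool :=
  [forall x, exists y in S, sedge x y].

(* If some vertex is isolated there is no total dominating set and the value
   is the default #|G|; see gamma_tP for the meaningful case. *)
Definition gamma_t : nat :=
  #|[arg min_(S < [set: G] | total_dominating S) #|S|]|.

Definition bipartition A B : Prop := A :|: B = [set: G] /\ [disjoint A & B].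

Definition bipartite : Prop :=
  exists X Y : {set G}, [/\ bipartition X Y, independent X & independent Y].

Section Induced.
Variable A : {set G}.

Definition induced_edge : rel {x : G | x \in A} :=
  [rel u v | sedge (val u) (val v)].

Lemma induced_edge_sym : symmetric induced_edge.
Proof. by move=> u v; apply: sedge_sym. Qed.

Lemma induced_edge_irrefl : irreflexive induced_edge.
Proof. by move=> u; apply: sedge_irrefl. Qed.

Definition induced : sgraph := SGraph induced_edge_sym induced_edge_irrefl.
End Induced.

Lemma gamma_tP :
  (forall x, exists y, sedge x y) ->
  (exists2 S, total_dominating S & #|S| = gamma_t) /\
  (forall S, total_dominating S -> gamma_t <= #|S|).
Proof.
move=> nbr; rewrite /gamma_t; case: arg_minnP => [|S tS minS].
  apply/forallP=> x; have [y xy] := nbr x.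
  by apply/existsP; exists y; rewrite inE.
by split=> //; exists S.
Qed.

End Graphs.

(* Blocks of the partition may a priori be empty; for r >= 2 and G nonempty,
   r-regularity of G excludes it. *)
Definition in_family_G (r : nat) (G : sgraph) : Prop :=
  [/\ regular G r, bipartite G &
      exists A B : {set G},
        [/\ bipartition A B, regular (induced A) r.-1 & regular (induced B) 1]].

(* Main.v *)
(** Let [n] be the order of [G]. Counting the edges between an independent set
    [I] and its complement gives [2 |I| <= n], with equality iff the complement
    is independent too; counting the edges at a total dominating set [S] gives
    [n <= r |S|], with equality iff every vertex has exactly one neighbour in
    [S]. So [2 alpha <= n <= r gamma_t], and equality throughout says that [G]
    is bipartite and that [(~: S, S)] is the partition defining the family. *)
Require Import Defs.
From mathcomp Require Import all_boot all_order all_algebra.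
Import Order.TTheory GRing.Theory Num.Theory.

Set Implicit Arguments.
Unset Strict Implicit.
Unset Printing Implicit Defensive.

(** Independence, total domination and regularity of an induced subgraph are all restated through
    this number, so that edge counts become sums of it. *)
Definition degree_in (G : sgraph) (A : {set G}) (x : G) : nat :=
  #|neighbors x :&: A|.

Section Counting.
Variable G : sgraph.
Implicit Types (x y : G) (A B S I : {set G}).

Lemma degree_inE A x : degree_in A x = \sum_(y in A) sedge x y.
Proof.
rewrite /degree_in -sum1_card [RHS]big_mkcond [LHS]big_mkcond /=.
by apply: eq_bigr => y _; rewrite !inE; case: sedge; case: (y \in A).
Qed.

(** Double counting of the adjacent pairs in [A] times [B], by first and by second component. *)
Lemma degree_in_exchange A B :
  \sum_(x in A) degree_in B x = \sum_(y in B) degree_in A y.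
Proof.
under eq_bigr do rewrite degree_inE.
rewrite exchange_big /=; apply: eq_bigr => y _.
by rewrite degree_inE; apply: eq_bigr => x _; rewrite sedge_sym.
Qed.

Lemma degree_inT x : degree_in setT x = #|neighbors x|.
Proof. by rewrite /degree_in setIT. Qed.

Lemma degree_inC A x : degree_in A x + degree_in (~: A) x = #|neighbors x|.
Proof. by rewrite /degree_in -setDE cardsID. Qed.

Lemma independentP I :
  reflect {in I, forall x, degree_in I x = 0} (independent I).
Proof.
apply: (iffP forall_inP) => [indI x Ix | indI x Ix].
  rewrite degree_inE big1 // => y Iy.
  by have /forall_inP/(_ y Iy)/negPf-> := indI x Ix.
apply/forall_inP=> y Iy; apply: contraPN (indI x Ix) => xy.
apply/eqP; rewrite /degree_in cards_eq0; apply/set0Pn.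
by exists y; rewrite !inE xy.
Qed.

Lemma total_dominatingP S :
  reflect (forall x, 0 < degree_in S x) (total_dominating S).
Proof.
apply: (iffP forallP) => H x.
  have /exists_inP[y Sy xy] := H x.
  by rewrite /degree_in card_gt0; apply/set0Pn; exists y; rewrite !inE xy.
have:= H x; rewrite /degree_in card_gt0 => /set0Pn[y].
by rewrite !inE => /andP[xy Sy]; apply/exists_inP; exists y.
Qed.

Lemma card_induced_neighbors A (u : induced A) :
  #|neighbors u| = degree_in A (val u).
Proof.
rewrite /degree_in -(card_imset _ (val_inj : injective (val : induced A -> G))).
apply: eq_card => y; rewrite !inE; apply/imsetP/andP => [[v uv ->]|[uy Ay]].
  by rewrite inE in uv; split=> //; apply: valP.
by exists (Sub y Ay) => //; rewrite inE.
Qed.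

Lemma regular_inducedP A k :
  regular (induced A) k <-> {in A, forall x, degree_in A x = k}.
Proof.
split=> [regA x Ax | degA u]; last by rewrite card_induced_neighbors degA ?(valP u).
by have := regA (Sub x Ax); rewrite card_induced_neighbors.
Qed.

Lemma bipartition_eqC A B : bipartition A B -> A = ~: B.
Proof.
case=> AB; rewrite disjoints_subset => sAB; apply/eqP.
rewrite eqEsubset sAB; apply/subsetP => x; have := in_setT x.
by rewrite -AB !inE => /orP[//|->].
Qed.

Lemma bipartitionC A : bipartition (~: A) A.
Proof. by split; [rewrite setUC setUCr | rewrite disjoints_subset]. Qed.

Lemma alphaP :
  (exists2 I : {set G}, independent I & #|I| = alpha G) /\
  (forall I : {set G}, independent I -> #|I| <= alpha G).
Proof.
split=> [|I indI]; last exact: (@leq_bigmax_cond _ _ (fun I : {set G} => #|I|)).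
(* The maximum is attained only over a nonempty family; the empty set provides a member. *)
have ind0: independent (set0 : {set G}) by apply/independentP => x; rewrite inE.
have [|I indI maxI] := @eq_bigmax_cond _ (@independent G) (fun I => #|I|).
  by apply/card_gt0P; exists set0.
by exists I; rewrite // -maxI.
Qed.

Section Regular.
Variable r : nat.
Hypotheses (r_gt0 : 0 < r) (regG : regular G r).

Lemma sum_degree_in S : \sum_x degree_in S x = r * #|S|.
Proof.
rewrite -(eq_bigl _ _ (@in_setT G)) degree_in_exchange.
by under eq_bigr do rewrite degree_inT regG; rewrite sum_nat_const mulnC.
Qed.

Lemma card_independent_leqif I : independent I ->
  2 * #|I| <= #|G| ?= iff independent (~: I).
Proof.
move=> /independentP indI.
(* Seen from [I], all [r] edges at each vertex cross to the complement. *)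
have cutI : \sum_(x in ~: I) degree_in I x = #|I| * r.
  rewrite -degree_in_exchange -sum_nat_const; apply: eq_bigr => x Ix.
  by rewrite -[RHS](regG x) -(degree_inC I) indI.
(* The slack at [x] is its degree inside [~: I], so the total slack vanishes exactly when [~: I] is
   independent. *)
have boundE x : degree_in I x <= r ?= iff (degree_in (~: I) x == 0).
  rewrite -(regG x) -(degree_inC I).
  by split; [exact: leq_addr | rewrite -{1}[degree_in I x]addn0 eqn_add2l eq_sym].
have := leqif_sum (fun x (_ : x \in ~: I) => boundE x).
rewrite cutI sum_nat_const => -[leI eqI]; rewrite leq_pmul2r // in leI.
rewrite eqn_pmul2r // in eqI; rewrite mul2n -addnn -(cardsC I).
split; first by rewrite leq_add2l.
rewrite eqn_add2l eqI; apply/forall_inP/independentP => H x Ix;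
  exact/eqP/H.
Qed.

(** The degrees into [S] sum to [r * #|S|], and each of these [#|G|] terms is at least 1. *)
Lemma card_total_dominating_leqif S : total_dominating S ->
  #|G| <= r * #|S| ?= iff [forall x, degree_in S x == 1].
Proof.
move=> /total_dominatingP domS; rewrite -sum_degree_in -sum1_card.
have boundE x : true -> 1 <= degree_in S x ?= iff (degree_in S x == 1).
  by split; [exact: domS | rewrite eq_sym].
have [le_sum eq_sum] := leqif_sum boundE.
by split=> //; rewrite eq_sum; apply: eq_forallb.
Qed.

(** Since [r] is positive no vertex is isolated, so [gamma_t] is a true minimum and not its default
    value. *)
Lemma gamma_t_regularP :
  (exists2 S : {set G}, total_dominating S & #|S| = gamma_t G) /\
  (forall S : {set G}, total_dominating S -> gamma_t G <= #|S|).
Proof.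
apply: gamma_tP => x; have: 0 < #|neighbors x| by rewrite regG.
by rewrite card_gt0 => /set0Pn[y]; rewrite inE; exists y.
Qed.

Lemma alpha_le_half_order : 2 * alpha G <= #|G|.
Proof. by have [[I indI <-] _] := alphaP; apply: card_independent_leqif. Qed.

Lemma order_le_gamma_t : #|G| <= r * gamma_t G.
Proof.
by have [[S domS <-] _] := gamma_t_regularP; apply: card_total_dominating_leqif.
Qed.

Lemma alpha_eq_half_orderP : 2 * alpha G = #|G| <-> bipartite G.
Proof.
split=> [eq_n | [X [Y [XY indX indY]]]].
  have [[I indI cardI] _] := alphaP; exists (~: I), I; split=> //.
    exact: bipartitionC.
  by rewrite -(card_independent_leqif indI) cardI eq_n.
(* The class [Y] has an independent complement, hence exactly half of the vertices, and [alpha G] is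
   at least its size. *)
apply/eqP; rewrite eqn_leq alpha_le_half_order.
have:= card_independent_leqif indY; rewrite -(bipartition_eqC XY) indX.
case=> _ /eqP <-; have [_ maxI] := alphaP.
by rewrite leq_pmul2l // maxI.
Qed.

Lemma order_eq_gamma_tP : #|G| = r * gamma_t G <->
  exists A B : {set G}, [/\ bipartition A B, regular (induced A) r.-1
                & regular (induced B) 1].
Proof.
have [[S domS cardS] minS] := gamma_t_regularP.
split=> [eq_n | [A [B [AB /regular_inducedP regA /regular_inducedP regB]]]].
  have: #|G| == r * #|S| by rewrite cardS eq_n.
  rewrite (card_total_dominating_leqif domS) => /forallP perfS.
  exists (~: S), S; split; first exact: bipartitionC.
    apply/regular_inducedP => x _.
    by rewrite -(regG x) -(degree_inC S) (eqP (perfS x)).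
  by apply/regular_inducedP => x _; apply/eqP.
(* A vertex of [A] has [r.-1] of its [r] neighbours in [A], which leaves one in [B]. *)
have perfB x : degree_in B x = 1.
  have [/regB //|nBx] := boolP (x \in B).
  have Ax : x \in A by rewrite (bipartition_eqC AB) inE.
  apply: (@addIn r.-1); rewrite add1n prednK // -{1}(regA x Ax) -(regG x).
  by rewrite {1}(bipartition_eqC AB) degree_inC.
have domB : total_dominating B by apply/total_dominatingP => x; rewrite perfB.
apply/eqP; rewrite eqn_leq order_le_gamma_t.
have/eqP-> : #|G| == r * #|B|.
  by rewrite (card_total_dominating_leqif domB); apply/forallP => x; apply/eqP.
by rewrite leq_pmul2l // minS.
Qed.

End Regular.
End Counting.

Local Open Scope ring_scope.

Theorem theorem1 (r : nat) (G : sgraph) (hr : (2 <= r)%N) (hG : regular G r) :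
  ((alpha G)%:R <= r%:R / 2%:R * (gamma_t G)%:R :> rat) /\
  ((alpha G)%:R = r%:R / 2%:R * (gamma_t G)%:R :> rat <-> in_family_G r G).
Proof.
have r_gt0 : (0 < r)%N by apply: ltnW.
have le_n := alpha_le_half_order r_gt0 hG.
have n_le := order_le_gamma_t r_gt0 hG.
have two_gt0 : 0 < 2%:R :> rat by rewrite ltr0n.
rewrite mulrAC; split.
  by rewrite ler_pdivlMr // mulrC -!natrM ler_nat (leq_trans le_n).
(* Clearing the denominator moves the equality to [nat], where the order of [G] lies between the two
   sides. *)
apply: (iff_trans (B := (2 * alpha G = r * gamma_t G)%N)).
  split=> [eq_rat | eq_nat]; apply/eqP.
    by rewrite -(eqr_nat rat) !natrM eq_rat mulrC divfK ?lt0r_neq0.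
  by rewrite -natrM -eq_nat natrM mulrAC divff ?mul1r ?lt0r_neq0.
split=> [eq_n | [_ bipG partG]].
  have eq_half : (2 * alpha G = #|G|)%N.
    by apply/eqP; rewrite eqn_leq le_n eq_n.
  split=> //; first by apply/(alpha_eq_half_orderP r_gt0 hG).
  by apply/(order_eq_gamma_tP r_gt0 hG); rewrite -eq_half.
rewrite (proj2 (alpha_eq_half_orderP r_gt0 hG) bipG).
exact/(order_eq_gamma_tP r_gt0 hG).
Qed.
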